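(* Let $N\in\mathbb N$, $n\in\{1,\dots,N-1\}$ and $a>-1/2$ be fixed, and consider the Racah polynomial $R_n^{(\alpha,\beta)}$ with $\alpha>-1$, $-1<\beta<2a+1$. If $a\ge 0$, the zeros of $R_n^{(\alpha,\beta)}$ are strictly decreasing functions of $\alpha$ on $(-1,\infty)$ and strictly increasing functions of $\beta$ on $(-1,2a+1)$. If $-1/2<a<0$, the zeros of $R_n^{(\alpha,\beta)}$ are strictly decreasing functions of $\alpha$ on $(-1,\infty)$ for each $\beta\in(a,2a+1)$ and strictly increasing functions of $\beta$ on $(a,2a+1)$.
   Context: The Racah polynomial is the polynomial of degree $n$ in the variable $X=x(s)=s(s+1)$ given by $$R_n^{(\alpha,\beta)}(X)={}_4F_3\left(\left.{-n,\,\alpha+\beta+n+1,\,a-s,\,s+a+1\atop 2a+\alpha+N+1,\,\beta+1,\,1-N}\right|1\right)=\sum_{k=0}^n\frac{(-n)_k(\alpha+\beta+n+1)_k(a-s)_k(s+a+1)_k}{(2a+\alpha+N+1)_k(\beta+1)_k(1-N)_k\,k!},$$ where $(u)_k=\prod_{j=1}^k(u+j-1)$. Zeros are zeros in the variable $X$; there are $n$ of them, real and distinct, lying in $(x(a),x(a+N-1))$. The statement refers to each zero (the zeros being arranged in increasing order) as a function of one parameter, the other parameters being fixed. *)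

(* Defs.v *)
From mathcomp Require Import all_boot all_order all_algebra.
From mathcomp Require Import all_reals.
From mathcomp Require Import polyrcf.
From mathcomp Require Import zify ring.

Set Implicit Arguments.
Unset Strict Implicit.
Unset Printing Implicit Defensive.

Import Order.TTheory GRing.Theory Num.Theory.
Local Open Scope ring_scope.

Section Racah.
Variable R : realType.
Implicit Types (N n k i : nat) (a al be u s : R).

Definition pochhammer u k : R := \prod_(1 <= j < k.+1) (u + j%:R - 1).

(* The factors of the k-th term of the 4F3 that do not involve s. *)
Definition racah_coef N n a al be k : R :=
  (pochhammer (- n%:R) k * pochhammer (al + be + n%:R + 1) k) /
  (pochhammer (2 * a + al + N%:R + 1) k * pochhammer (be + 1) k *
   pochhammer (1 - N%:R) k * k`!%:R).

Definition racah_4F3 N n a al be s : R :=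
  \sum_(0 <= k < n.+1)
    (pochhammer (- n%:R) k * pochhammer (al + be + n%:R + 1) k *
     pochhammer (a - s) k * pochhammer (s + a + 1) k) /
    (pochhammer (2 * a + al + N%:R + 1) k * pochhammer (be + 1) k *
     pochhammer (1 - N%:R) k * k`!%:R).

(* With X = s (s + 1) one has
     (a - s + j) (s + a + 1 + j) = (a + j) (a + j + 1) - X,
   so (a - s)_k (s + a + 1)_k is a polynomial in X; see racahE and
   racah_unique for the link with the hypergeometric sum. *)
Definition racah N n a al be : {poly R} :=
  \sum_(0 <= k < n.+1) racah_coef N n a al be k *:
    \prod_(0 <= j < k) (((a + j%:R) * (a + j%:R + 1))%:P - 'X).

(* rootsR p lists the real roots of p, without multiplicity, in strictly
   increasing order, so this is the i-th smallest zero, counting from 0.  For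
   1 <= n <= N - 1, a > -1/2, al > -1 and -1 < be < 2 a + 1, the list has n
   entries and the default value of nth is never reached for i < n. *)
Definition racah_zero N n a al be i : R := (rootsR (racah N n a al be))`_i.

Lemma racahE N n a al be s :
  (racah N n a al be).[s * (s + 1)] = racah_4F3 N n a al be s.
Proof.
rewrite /racah /racah_4F3 horner_sum; apply: eq_bigr => k _.
rewrite hornerZ horner_prod /racah_coef.
have -> : \prod_(0 <= j < k)
    (((a + j%:R) * (a + j%:R + 1))%:P - 'X).[s * (s + 1)] =
    pochhammer (a - s) k * pochhammer (s + a + 1) k.
  rewrite /pochhammer -big_split big_add1 /=.
  apply: eq_bigr => j _; rewrite !hornerE -natr1; ring.
by rewrite mulrAC !mulrA.
Qed.

Lemma racah_unique N n a al be (p : {poly R}) :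
  (forall s, p.[s * (s + 1)] = racah_4F3 N n a al be s) ->
  p = racah N n a al be.
Proof.
move=> pE; apply/eqP; rewrite -subr_eq0; apply/negPn/negP => q0.
set q := p - _ in q0.
pose rs : seq R := [seq k%:R * (k%:R + 1) | k <- iota 0 (size q)].
have rs_roots : all (root q) rs.
  by apply/allP => _ /mapP[k _ ->]; rewrite rootE /q !hornerE pE racahE subrr.
have rs_uniq : uniq rs.
  rewrite map_inj_uniq ?iota_uniq// => k l /eqP.
  rewrite !natr1 -!natrM eqr_nat => /eqP kl.
  nia.
by have := max_poly_roots q0 rs_roots rs_uniq; rewrite size_map size_iota ltnn.
Qed.

End Racah.

(* Main.v *)
Require Import Defs.
From mathcomp Require Import all_boot all_order all_algebra.
From mathcomp Require Import all_reals.
From mathcomp Require Import polyrcf.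
From mathcomp Require Import zify ring lra.
Import Order.TTheory GRing.Theory Num.Theory.
Local Open Scope ring_scope.

(* The Racah polynomials are orthogonal on the N nodes X_k = (a + k)(a + k + 1):
   the difference operator f |-> B(k)(f(k+1) - f(k)) + D(k)(f(k-1) - f(k)) is
   self-adjoint for the weight w with w(k) B(k) = w(k+1) D(k+1), has R_n as an
   eigenvector, and is triangular in the basis prod_(j < m) (X_j - X) with
   distinct eigenvalues. Raising al (resp. be) multiplies w by a strictly
   decreasing (resp. increasing) function of k, and Markov's theorem says that
   the zeros move accordingly. Markov's theorem is obtained without derivatives,
   from the positivity of Gauss quadrature applied to (x - t) f^2. *)

(** * Orthogonal polynomials on finitely many nodes and Markov's theorem *)

Section DiscreteOrthogonality.
Variables (R : rcfType) (N : nat) (x : nat -> R).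
Implicit Types (w : nat -> R) (p q f g : {poly R}) (n i j k : nat).
Hypothesis x_incr : {homo x : j k / (j < k)%N >-> j < k}.

Definition dsum w q : R := \sum_(k < N) w k * q.[x k].

Definition ortho_poly w n p :=
  size p = n.+1 /\ forall q, (size q <= n)%N -> dsum w (p * q) = 0.

Lemma dsumD w p q : dsum w (p + q) = dsum w p + dsum w q.
Proof.
by rewrite -big_split /=; apply: eq_bigr => k _; rewrite hornerD mulrDr.
Qed.

Lemma dsumZ w c q : dsum w (c *: q) = c * dsum w q.
Proof. by rewrite mulr_sumr; apply: eq_bigr => k _; rewrite hornerZ mulrCA. Qed.

Lemma nodes_vanish q : (size q <= N)%N ->
  (forall k, (k < N)%N -> root q (x k)) -> q = 0.
Proof.
move=> sq q0; apply: (@roots_geq_poly_eq0 _ _ [seq x k | k <- iota 0 N]).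
- by apply/allP => _ /mapP[k + ->]; rewrite mem_iota; apply: q0.
- rewrite map_inj_uniq ?iota_uniq// => j k xjk.
  by case: (ltngtP j k) => // /x_incr; rewrite xjk ltxx.
- by rewrite size_map size_iota.
Qed.

(** By the intermediate value theorem between 0 and [z], the sign at 0 persists everywhere. *)
Lemma const_sign p : (forall z, ~~ root p z) ->
  exists b : bool, forall z, 0 <= (-1) ^+ b * p.[z].
Proof.
move=> p_nz; exists (p.[0] < 0) => z; rewrite leNgt; apply/negP => pz_lt0.
suff pz0 : p.[0] * p.[z] <= 0.
  case: (leP 0 z) => [z0|/ltW z0].
  - by have [y _] := polyrcf.poly_ivt z0 pz0; apply/negP.
  - by rewrite mulrC in pz0; have [y _] := polyrcf.poly_ivt z0 pz0; apply/negP.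
move: pz_lt0; case: (ltP p.[0] 0) => p0;
  rewrite ?expr0 ?expr1 ?mul1r ?mulN1r => pz.
- by rewrite nmulr_rle0 // ltW -?oppr_lt0.
- by rewrite mulr_ge0_le0 // ltW.
Qed.

(* The entries of zs are the sign changes of p. *)
Lemma sign_factor p : p != 0 -> exists (zs : seq R) (g : {poly R}) (b : bool),
  [/\ uniq zs, p = \prod_(z <- zs) ('X - z%:P) * g &
      forall y, 0 <= (-1) ^+ b * g.[y]].
Proof.
elim: {p}(size p) {-2}p (leqnn (size p)) => [|m IH] p.
  by rewrite leqn0 size_poly_eq0 => ->.
move=> sp p0.
have [[z pz]|noroot] : (exists z, root p z) \/ (forall z, ~~ root p z).
  have := roots_on_rootsR p0; case: (rootsR p) => [|z zs] on; last first.
    by left; exists z; have := on z; rewrite mem_head => /andP[].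
  by right=> z; have := on z; rewrite in_itv /= in_nil => ->.
- have [p' pE] := factor_theorem _ _ pz.
  have p'0 : p' != 0 by apply: contraNneq p0; rewrite pE => ->; rewrite mul0r.
  have [|zs [g [b [u p'E gb]]]] := IH p' _ p'0.
    by move: sp; rewrite pE size_mul ?polyXsubC_eq0// size_XsubC addn2.
  case: (boolP (z \in zs)) => zzs; last first.
    exists (z :: zs), g, b; split => //; first by rewrite /= zzs.
    by rewrite big_cons pE p'E mulrC mulrA.
  (* A second occurrence of [z] cancels the first: the square joins the factor of constant sign. *)
  exists (rem z zs), (('X - z%:P) ^+ 2 * g), b; split; first exact: rem_uniq.
    rewrite pE p'E (perm_big _ (perm_to_rem zzs)) big_cons /=; ring.
  move=> y; rewrite hornerM mulrCA mulr_ge0// horner_exp; exact: sqr_ge0.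
- have [b bP] := const_sign _ noroot.
  by exists [::], p, b; split => //; rewrite big_nil mul1r.
Qed.

(* Otherwise the product q of the sign changes of p has degree < n, and p q,
   of constant sign with vanishing sum, vanishes at every node. *)
Lemma ortho_roots w n p : (n < N)%N -> (forall k, (k < N)%N -> 0 < w k) ->
  ortho_poly w n p -> size (rootsR p) = n.
Proof.
move=> nN w_gt0 [sp op].
have p0 : p != 0 by rewrite -size_poly_eq0 sp.
have rootsE : forall z, (z \in rootsR p) = root p z.
  by move=> z; have := roots_on_rootsR p0 z; rewrite in_itv.
have uR : uniq (rootsR p) := uniq_roots _ _ _.
apply/eqP; rewrite eqn_leq; apply/andP; split.
  rewrite -ltnS -sp; apply: max_poly_roots => //.
  by apply/allP => z; rewrite rootsE.
have [zs [g [b [u pE gb]]]] := sign_factor _ p0.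
have zroots : {subset zs <= rootsR p}.
  by move=> z zzs; rewrite rootsE pE rootM root_prod_XsubC zzs.
apply: leq_trans (uniq_leq_size u zroots).
rewrite leqNgt; apply/negP => szs.
set q := \prod_(z <- zs) ('X - z%:P) in pE.
have q0 : q != 0 by apply: contraNneq p0; rewrite pE => ->; rewrite mul0r.
have sum0 : dsum w ((-1) ^+ b *: (p * q)) = 0.
  by rewrite dsumZ op ?mulr0// /q size_prod_XsubC.
have pq_ge0 y : 0 <= ((-1) ^+ b *: (p * q)).[y].
  rewrite hornerZ pE; have -> : q * g * q = q ^+ 2 * g by ring.
  by rewrite hornerM mulrCA mulr_ge0// horner_exp sqr_ge0.
(* As [p] has degree n < N, it is enough that it vanish at all N nodes. *)
have /nodes_vanish p_eq0 : (size p <= N)%N by rewrite sp.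
case/eqP: p0; apply: p_eq0 => k kN.
have term_ge0 (j : 'I_N) : true -> 0 <= w j * ((-1) ^+ b *: (p * q)).[x j].
  by move=> _; rewrite mulr_ge0 // ltW ?w_gt0.
have /eqP := @psumr_eq0P _ _ _ _ term_ge0 sum0 (Ordinal kN) isT => /=.
rewrite mulf_eq0 gt_eqF ?w_gt0 //= hornerZ mulf_eq0 signr_eq0 /=.
rewrite hornerM mulf_eq0.
case/orP=> [//|qk]; rewrite rootE pE hornerM.
by rewrite (eqP qk) mul0r.
Qed.

(** Newton interpolation: the correction is a multiple of [P], which vanishes at the earlier points
    but not at [z]. *)
Lemma interpolation (zs : seq R) (v : R -> R) : uniq zs ->
  exists2 h : {poly R}, (size h <= size zs)%N & {in zs, forall z, h.[z] = v z}.
Proof.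
elim: zs => [|z zs IH] /=; first by exists 0; rewrite ?size_poly0.
case/andP=> zzs /IH[h sh hv].
pose P := \prod_(y <- zs) ('X - y%:P) : {poly R}.
have Pz : P.[z] != 0 by rewrite -rootE root_prod_XsubC.
exists (h + ((v z - h.[z]) / P.[z]) *: P).
  apply: leq_trans (size_polyD _ _) _; rewrite geq_max ltnW //=.
  by apply: leq_trans (size_scale_leq _ _) _; rewrite size_prod_XsubC.
move=> y; rewrite inE hornerD hornerZ => /predU1P[->|yzs].
  by rewrite divfK // addrC subrK.
have /rootP -> : root P y by rewrite root_prod_XsubC.
by rewrite mulr0 addr0 hv.
Qed.

(* Positivity of Gauss quadrature: g - h^2 is a multiple of p when h
   interpolates the square root of g at the roots of p. *)
Lemma gauss_ge0 w n p g : (n < N)%N -> (forall k, (k < N)%N -> 0 < w k) ->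
  ortho_poly w n p -> (size g <= n.*2)%N ->
  (forall z, root p z -> 0 <= g.[z]) -> 0 <= dsum w g.
Proof.
move=> nN w_gt0 op sg g_ge0; have szR := ortho_roots _ _ _ nN w_gt0 op.
case: op => sp op.
have p0 : p != 0 by rewrite -size_poly_eq0 sp.
have rootsE : forall z, (z \in rootsR p) = root p z.
  by move=> z; have := roots_on_rootsR p0 z; rewrite in_itv.
have uR : uniq (rootsR p) := uniq_roots _ _ _.
have [h sh hE] := interpolation (rootsR p) (fun z => Num.sqrt g.[z]) uR.
rewrite szR in sh.
(* [p] has as many roots as its degree, so they are simple and divisibility by [p] can be tested on
   them. *)
have pE : p = lead_coef p *: \prod_(z <- rootsR p) ('X - z%:P).
  apply: all_roots_prod_XsubC; rewrite ?szR// ?uniq_rootsE//.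
  by apply/allP => z; rewrite rootsE.
have dvd : p %| g - h ^+ 2.
  rewrite pE dvdpZl ?lead_coef_eq0//; apply: uniq_roots_dvdp; last first.
    by rewrite uniq_rootsE.
  apply/allP => z zR; rewrite rootE hornerD hornerN horner_exp hE// sqr_sqrtr.
    by rewrite subrr.
  by apply: g_ge0; rewrite -rootsE.
have [q gE] : exists q : {poly R}, g - h ^+ 2 = q * p by apply/dvdpP.
have -> : g = p * q + h ^+ 2 by rewrite mulrC -gE subrK.
have sh2 : (size (h ^+ 2)%R <= n.*2)%N.
  by rewrite expr2; have := size_polyMleq h h; move: sh; lia.
(* The bound 2n on the size of [g] leaves a quotient small enough to be orthogonal to [p]. *)
have sq : (size q <= n)%N.
  have [->|q0] := eqVneq q 0; first by rewrite size_poly0.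
  have : (size (q * p)%R <= n.*2)%N.
    rewrite -gE; apply: leq_trans (size_polyD _ _) _.
    by rewrite geq_max size_polyN sg sh2.
  by rewrite size_mul // sp addnS /= -addnn leq_add2r.
rewrite dsumD op // add0r; apply: sumr_ge0 => k _.
by rewrite mulr_ge0 ?horner_exp ?sqr_ge0// ltW ?w_gt0.
Qed.

(* With r = W / w increasing, the pivot j is the last node not exceeding t,
   or the first node. *)
Lemma monotone_pivot (r : nat -> R) t : (0 < N)%N ->
  (forall j k, (j < k < N)%N -> r j < r k) ->
  exists2 j, (j < N)%N &
    forall k, (k < N)%N -> k != j -> 0 < (x k - t) * (r k - r j).
Proof.
move=> N_gt0 r_incr.
have [j jN /andP[below above]] : exists2 j, (j < N)%N &
    [forall k : 'I_N, (k < j)%N ==> (x k < t)] &&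
    [forall k : 'I_N, (j < k)%N ==> (t < x k)].
  have [j xj|none] := pickP (fun j : 'I_N => x j <= t).
  - have ex : exists j, (j < N)%N && (x j <= t) by exists j; rewrite ltn_ord.
    have bd i : (i < N)%N && (x i <= t) -> (i <= N)%N by case/andP => /ltnW.
    case: (ex_maxnP ex bd) => m /andP[mN xm] m_max; exists m => //.
    apply/andP; split; apply/forallP => k; apply/implyP => mk.
      exact: lt_le_trans (x_incr _ _ mk) xm.
    rewrite ltNge; apply/negP => xk.
    by have := m_max k; rewrite ltn_ord xk leqNgt mk => /(_ isT).
  - exists 0%N => //; apply/andP; split; apply/forallP => k; apply/implyP => //.
    by move=> _; rewrite ltNge none.
exists j => // k kN.
case: ltngtP => // jk _.
- have /forallP/(_ (Ordinal kN))/implyP/(_ jk) /= xk := below.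
  by rewrite nmulr_rgt0 subr_lt0 // r_incr ?jk.
- have /forallP/(_ (Ordinal kN))/implyP/(_ jk) /= xk := above.
  by rewrite pmulr_rgt0 subr_gt0 // r_incr ?jk.
Qed.

(* Markov's monotonicity theorem, without differentiation. If X_i <= t := x_i,
   put f := prod_(j < i) (X - x_j) * prod_(j > i) (X - X_j). Quadrature for w
   gives \sum w (x - t) f^2 >= 0, quadrature for W gives
   \sum W (x - t) f^2 <= 0, but W (x - t) >= r_j w (x - t) for the pivot j,
   with strict inequality at the other nodes. *)
Lemma markov_zeros w W n p P i : (n < N)%N ->
  (forall k, (k < N)%N -> 0 < w k) -> (forall k, (k < N)%N -> 0 < W k) ->
  (forall j k, (j < k < N)%N -> W j / w j < W k / w k) ->
  ortho_poly w n p -> ortho_poly W n P -> (i < n)%N ->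
  (rootsR p)`_i < (rootsR P)`_i.
Proof.
move=> nN w_gt0 W_gt0 r_incr op oP i_n.
have szp := ortho_roots _ _ _ nN w_gt0 op.
have szP := ortho_roots _ _ _ nN W_gt0 oP.
have p0 : p != 0 by rewrite -size_poly_eq0 (proj1 op).
have P0 : P != 0 by rewrite -size_poly_eq0 (proj1 oP).
rewrite ltNge; apply/negP => le_t.
set t := (rootsR p)`_i in le_t.
have n_gt0 : (0 < n)%N by apply: leq_ltn_trans i_n.
have sorted_p : sorted <%R (rootsR p) := sorted_roots _ _ _.
have sorted_P : sorted <%R (rootsR P) := sorted_roots _ _ _.
pose zs := take i (rootsR p) ++ drop i.+1 (rootsR P).
pose f : {poly R} := \prod_(z <- zs) ('X - z%:P).
(* The i-th root of each list is left out, so [f] has degree n - 1 and [g] degree 2n - 1, within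
   reach of the quadrature. *)
have szf : size f = n.
  rewrite size_prod_XsubC size_cat size_drop szP size_takel; last first.
    by rewrite szp; exact: ltnW.
  by rewrite -addnS (subnSK i_n) (subnKC (ltnW i_n)).
have f0 : f != 0 by rewrite -size_poly_eq0 szf -lt0n.
pose g : {poly R} := ('X - t%:P) * f ^+ 2.
have gE y : g.[y] = (y - t) * f.[y] ^+ 2.
  by rewrite hornerM hornerXsubC horner_exp.
have szg : (size g <= n.*2)%N.
  have := size_polyMleq ('X - t%:P) (f ^+ 2); rewrite -/g.
  have := size_polyMleq f f; rewrite -expr2 size_XsubC szf.
  by move: n_gt0 {g gE} (size g) (size (f ^+ 2)%R); clear; lia.
have [j jN piv] := monotone_pivot (fun k => W k / w k) t
  (leq_ltn_trans (leq0n _) nN) r_incr.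
have w_ge0 : 0 <= dsum w g.
  apply: (gauss_ge0 _ _ _ _ nN w_gt0 op szg) => z pz; rewrite gE.
  have /(nthP 0)[l lp <-] : z \in rootsR p.
    by have := roots_on_rootsR p0 z; rewrite in_itv /= => <-.
  (* Roots of [p] before the i-th are roots of [f]; the others are at least [t]. *)
  case: (ltnP l i) => [li|il].
    have /rootP -> : root f (rootsR p)`_l; last by rewrite expr0n mulr0.
    rewrite root_prod_XsubC mem_cat; apply/orP; left.
    by rewrite -(nth_take 0 li) mem_nth // size_takel // szp ltnW.
  rewrite mulr_ge0 ?sqr_ge0 // subr_ge0 /t (lt_sorted_leq_nth 0 sorted_p) //.
  by rewrite inE szp.
have W_le0 : 0 <= dsum W (- g).
  apply: (gauss_ge0 _ _ _ _ nN W_gt0 oP) => [|z Pz].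
    by rewrite size_polyN.
  rewrite hornerN gE.
  have /(nthP 0)[l lP <-] : z \in rootsR P.
    by have := roots_on_rootsR P0 z; rewrite in_itv /= => <-.
  case: (ltnP i l) => [il|li].
    have /rootP -> : root f (rootsR P)`_l; last by rewrite expr0n mulr0 oppr0.
    rewrite root_prod_XsubC mem_cat; apply/orP; right.
    rewrite -{1}(subnKC il) -nth_drop mem_nth // size_drop.
    by rewrite ltn_sub2r // (leq_ltn_trans il).
  rewrite -mulNr mulr_ge0 ?sqr_ge0 // oppr_ge0 subr_le0.
  apply: le_trans le_t.
  by rewrite (lt_sorted_leq_nth 0 sorted_P) // inE szP.
(* The ratio at the pivot is positive, so this contradicts the two quadrature signs. *)
suff : 0 < dsum W g - W j / w j * dsum w g.
  move: W_le0; rewrite -scaleN1r dsumZ mulN1r oppr_ge0 => W_le0.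
  rewrite subr_gt0 => lt; have := lt_le_trans lt W_le0.
  by rewrite ltNge mulr_ge0 // divr_ge0 // ltW ?W_gt0 ?w_gt0.
have -> : dsum W g - W j / w j * dsum w g =
    \sum_(k < N) w k * ((x k - t) * (W k / w k - W j / w j)) * f.[x k] ^+ 2.
  rewrite mulr_sumr -sumrB; apply: eq_bigr => k _; rewrite gE.
  have wk0 : w k != 0 by rewrite gt_eqF ?w_gt0.
  have wj0 : w j != 0 by rewrite gt_eqF ?w_gt0.
  by field; rewrite wk0 wj0.
have term_ge0 (k : 'I_N) : true ->
    0 <= w k * ((x k - t) * (W k / w k - W j / w j)) * f.[x k] ^+ 2.
  move=> _; rewrite mulr_ge0 ?sqr_ge0 // mulr_ge0 // ?(ltW (w_gt0 _ _)) //.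
  have [->|kj] := eqVneq (k : nat) j; first by rewrite subrr mulr0.
  by rewrite ltW // piv.
rewrite lt0r sumr_ge0 // andbT; apply/eqP => sum0.
have froot k : (k < N)%N -> k != j -> root f (x k).
  move=> kN kj.
  have /eqP := @psumr_eq0P _ _ _ _ term_ge0 sum0 (Ordinal kN) isT => /=.
  by rewrite mulf_eq0 sqrf_eq0 gt_eqF // mulr_gt0 ?w_gt0 ?piv.
(* A zero sum forces [f] to vanish at every node but the pivot; the linear factor takes care of the
   pivot, and the size n + 1 is still at most N. *)
suff /eqP : ('X - (x j)%:P) * f = 0.
  by rewrite mulf_eq0 polyXsubC_eq0 (negPf f0).
apply: nodes_vanish => [|k kN].
  by rewrite size_mul ?polyXsubC_eq0 // size_XsubC szf.
rewrite rootM root_XsubC.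
by have [->|kj] := eqVneq k j; rewrite ?eqxx //= froot // orbT.
Qed.

End DiscreteOrthogonality.

(** * Birth-and-death operators and summation by parts *)

Section SelfAdjoint.
Variables (R : comNzRingType) (B D w : nat -> R).
Implicit Types (f g : nat -> R).

Definition birth_death f k : R :=
  B k * (f k.+1 - f k) + D k * (f k.-1 - f k).

(** Detailed balance merges the upward term at k with the downward term at k + 1, and the boundary
    rates vanish. The resulting Dirichlet form is symmetric in [f] and [g]. *)
Lemma birth_death_sum N f g : D 0 = 0 -> B N = 0 ->
  (forall k, (k < N)%N -> w k * B k = w k.+1 * D k.+1) ->
  \sum_(k < N.+1) w k * (birth_death f k * g k) =
  - \sum_(k < N) w k * B k * (f k.+1 - f k) * (g k.+1 - g k).
Proof.
move=> D0 BN detailed.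
transitivity (\sum_(k < N.+1) w k * B k * (f k.+1 - f k) * g k +
              \sum_(k < N.+1) w k * D k * (f k.-1 - f k) * g k).
  by rewrite -big_split; apply: eq_bigr => k _; rewrite /birth_death /=; ring.
rewrite big_ord_recr /= BN mulr0 !mul0r addr0.
rewrite [in X in _ + X]big_ord_recl /= D0 mulr0 !mul0r add0r -big_split -sumrN.
apply: eq_bigr => k _ /=; rewrite /bump leq0n add1n /= -detailed //; ring.
Qed.

Lemma birth_death_sym N f g : D 0 = 0 -> B N = 0 ->
  (forall k, (k < N)%N -> w k * B k = w k.+1 * D k.+1) ->
  \sum_(k < N.+1) w k * (birth_death f k * g k) =
  \sum_(k < N.+1) w k * (f k * birth_death g k).
Proof.
move=> D0 BN detailed; rewrite birth_death_sum //.
under [RHS]eq_bigr => k _ do rewrite [f k * _]mulrC.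
by rewrite birth_death_sum //; congr (- _); apply: eq_bigr => k _; ring.
Qed.

End SelfAdjoint.

(** * Pochhammer symbols, Racah nodes and the triangular basis *)

Section RacahOrthogonality.
Variable R : realType.
Implicit Types (N n k m : nat) (a al be u x c : R).

Lemma pochhammer0 u : pochhammer u 0 = 1.
Proof. by rewrite /pochhammer big_geq. Qed.

Lemma pochhammerSr u k : pochhammer u k.+1 = pochhammer u k * (u + k%:R).
Proof. by rewrite /pochhammer big_nat_recr //= -natr1 addrA addrK. Qed.

Lemma pochhammerSl u k : pochhammer u k.+1 = u * pochhammer (u + 1) k.
Proof.
elim: k => [|k IH]; first by rewrite pochhammerSr !pochhammer0; ring.
by rewrite pochhammerSr IH pochhammerSr -natr1; ring.
Qed.

Lemma pochhammer_neq0 u k :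
  (forall j, (j < k)%N -> u + j%:R != 0) -> pochhammer u k != 0.
Proof.
elim: k => [|k IH] u_nz; first by rewrite pochhammer0 oner_neq0.
by rewrite pochhammerSr mulf_neq0 ?u_nz // IH // => j jk; rewrite u_nz // ltnW.
Qed.

Definition racah_node a k : R := (a + k%:R) * (a + k%:R + 1).

Definition racah_basis a m : {poly R} :=
  \prod_(0 <= j < m) ((racah_node a j)%:P - 'X).

Lemma racah_node_incr a : - (1 / 2) < a ->
  {homo racah_node a : j k / (j < k)%N >-> j < k}.
Proof.
move=> a_gt j k jk; rewrite -subr_gt0 /racah_node.
have j0 : 0 <= j%:R :> R := ler0n _ _.
have : (j%:R + 1 <= k%:R :> R) by rewrite natr1 ler_nat.
set u := j%:R in j0 *; set v := k%:R => uv.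
have -> : (a + v) * (a + v + 1) - (a + u) * (a + u + 1) =
  (v - u) * (2 * a + 1 + u + v) by ring.
by apply: mulr_gt0; lra.
Qed.

(** Factor by factor: X_j - X_k = (j - k)(j + k + 2a + 1). *)
Lemma racah_basis_node a m k : (racah_basis a m).[racah_node a k] =
  pochhammer (- k%:R) m * pochhammer (k%:R + (2 * a + 1)) m.
Proof.
elim: m => [|m IH].
  by rewrite /racah_basis big_geq // !pochhammer0 hornerC mulr1.
rewrite !pochhammerSr /racah_basis big_nat_recr // hornerM.
rewrite -/(racah_basis a m) IH.
by rewrite hornerD hornerN hornerC hornerX /racah_node; ring.
Qed.

Lemma racah_basis_lead a m :
  size (racah_basis a m) = m.+1 /\ lead_coef (racah_basis a m) != 0.
Proof.
suff E : racah_basis a m =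
    (-1) ^+ m *: \prod_(j < m) ('X - (racah_node a j)%:P).
  have sz := size_prod_XsubC (enum 'I_m) (fun j : 'I_m => racah_node a j).
  rewrite E size_scale ?signr_eq0 // lead_coefZ.
  rewrite (monicP (monic_prod_XsubC _ _ _)) mulr1 signr_eq0; split=> //.
  by rewrite -big_enum sz size_enum_ord.
elim: m => [|m IH]; first by rewrite /racah_basis big_geq // big_ord0 scale1r.
rewrite /racah_basis big_nat_recr // -/(racah_basis a m) IH big_ord_recr /=.
by rewrite exprSr mulrN1 -opprB mulrN -scalerAl scaleNr.
Qed.

(** * The Racah difference equation and orthogonality *)

Section FixedWeight.
Variables (N : nat) (a al be : R).
Let c := 2 * a + 1.

(** Upward rate of the Racah difference equation on the nodes; it vanishes at the last node, k = N -
    1. *)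
Definition racah_birth k : R :=
  (k%:R + be + 1) * (k%:R + al + c + N%:R) * (N%:R - 1 - k%:R) * (k%:R + c) /
  ((2 * k%:R + c) * (2 * k%:R + c + 1)).

(* At a = 0 the denominator vanishes for k = 0, where the factor k makes the
   value 0 in any case. *)
Definition racah_death k : R :=
  k%:R * (k%:R - be + c - 1) * (N%:R + al - k%:R) * (k%:R + c - 1 + N%:R) /
  ((2 * k%:R + c - 1) * (2 * k%:R + c)).

(* The quotient racah_birth k / racah_death k.+1. *)
Definition racah_step k : R :=
  (k%:R + be + 1) / (k%:R + c - be) *
  ((k%:R + al + c + N%:R) / (N%:R + al - k%:R - 1)) *
  ((N%:R - 1 - k%:R) * (k%:R + c) * (2 * k%:R + c + 2) /
   ((2 * k%:R + c) * (k%:R + 1) * (k%:R + c + N%:R))).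

(** The Racah weight, normalised to 1 at k = 0. Successive ratios reduce detailed balance and the
    comparison of two weights to a single step. *)
Definition racah_weight k : R := \prod_(j < k) racah_step j.

Definition racah_eig m : R := m%:R * (m%:R + al + be + 1).

(** Off-diagonal entry of the operator in [racah_basis], and also the factor that the denominator of
    [racah_coef] gains from m to m + 1. *)
Definition racah_lower m : R :=
  (m%:R + 1) * (m%:R + al + c + N%:R) * (m%:R + be + 1) * (1 - N%:R + m%:R).

Hypotheses (a_gt : - (1 / 2) < a) (al_gt : -1 < al).
Hypotheses (be_gt : -1 < be) (be_lt : be < 2 * a + 1).

(** [be < 2 * a + 1] keeps k + c - be positive, and [-1 < al] with k + 2 <= N keeps N + al - k - 1
    positive. *)
Lemma racah_step_gt0 k : (k.+1 < N)%N -> 0 < racah_step k.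
Proof.
move: a_gt al_gt be_gt be_lt => a0 al0 be0 bec kN.
have k0 : 0 <= k%:R :> R := ler0n _ _.
have : k%:R + 2 <= N%:R :> R by rewrite -natrD ler_nat addn2.
rewrite /racah_step /c; move: k%:R (N%:R : R) k0 => x y x0 xy.
by repeat (apply: mulr_gt0 || rewrite invr_gt0); lra.
Qed.

Lemma racah_weight_gt0 k : (k < N)%N -> 0 < racah_weight k.
Proof.
move=> kN; apply: prodr_gt0 => j _; apply: racah_step_gt0.
by apply: leq_ltn_trans kN.
Qed.

Lemma racah_weightS k : racah_weight k.+1 = racah_weight k * racah_step k.
Proof. by rewrite /racah_weight big_ord_recr. Qed.

Lemma racah_weight_balance k : (k.+1 < N)%N ->
  racah_weight k * racah_birth k = racah_weight k.+1 * racah_death k.+1.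
Proof.
move: a_gt al_gt be_gt be_lt => a0 al0 be0 bec kN.
rewrite racah_weightS -mulrA; congr (_ * _).
have k0 : 0 <= k%:R :> R := ler0n _ _.
have : k%:R + 2 <= N%:R :> R by rewrite -natrD ler_nat addn2.
rewrite /racah_birth /racah_step /racah_death /c -[k.+1%:R]natr1.
move: k%:R (N%:R : R) k0 => x y x0 xy.
by field; repeat (apply/andP; split); apply: lt0r_neq0; lra.
Qed.

Local Notation rL f k := (birth_death _ racah_birth racah_death f k).

(** Shifting k by one changes the Pochhammer products only at their ends, so each difference times
    its rate is a rational multiple of [P * Q], the value of the basis polynomial of index m. An
    identity of rational functions remains. *)
Lemma racah_basis_eig m k :
  rL (fun j => (racah_basis a m.+1).[racah_node a j]) k =
  - racah_eig m.+1 * (racah_basis a m.+1).[racah_node a k] +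
  racah_lower m * (racah_basis a m).[racah_node a k].
Proof.
move: a_gt al_gt be_gt be_lt => a0 al0 be0 bec.
have k0 : 0 <= k%:R :> R := ler0n _ _.
rewrite /birth_death !racah_basis_node -/c -[k.+1%:R]natr1.
set x : R := k%:R in k0 *; set P := pochhammer (- x) m.
set Q := pochhammer (x + c) m.
have up : racah_birth k *
    (pochhammer (- (x + 1)) m.+1 * pochhammer (x + 1 + c) m.+1 -
     pochhammer (- x) m.+1 * pochhammer (x + c) m.+1) =
    - m.+1%:R * ((x + be + 1) * (x + al + c + N%:R) * (N%:R - 1 - x)) *
    (x + c + m%:R) / (2 * x + c) * (P * Q).
  (* The factor k + c of the birth rate restores [Q]. *)
  have Q' : (x + c) * pochhammer (x + 1 + c) m = Q * (x + c + m%:R).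
    by rewrite /Q -pochhammerSr pochhammerSl addrAC.
  rewrite [pochhammer (- (x + 1)) _]pochhammerSl.
  rewrite [pochhammer (x + 1 + c) _]pochhammerSr.
  rewrite [pochhammer (- x) _]pochhammerSr [pochhammer (x + c) _]pochhammerSl.
  have -> : - (x + 1) + 1 = - x by ring.
  have -> : x + c + 1 = x + 1 + c by ring.
  rewrite -/P /racah_birth -/x.
  transitivity (- m.+1%:R * ((x + be + 1) * (x + al + c + N%:R) *
    (N%:R - 1 - x)) / (2 * x + c) *
    (P * ((x + c) * pochhammer (x + 1 + c) m))); last by rewrite Q'; ring.
  rewrite -[m.+1%:R]natr1.
  move: (pochhammer _ _) (N%:R : R) (m%:R : R) => Y y z.
  by rewrite /c; field; apply/andP; split; apply: lt0r_neq0; lra.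
have down : racah_death k *
    (pochhammer (- k.-1%:R) m.+1 * pochhammer (k.-1%:R + c) m.+1 -
     pochhammer (- x) m.+1 * pochhammer (x + c) m.+1) =
    - m.+1%:R * ((x - be + c - 1) * (N%:R + al - x) * (x + c - 1 + N%:R)) *
    (m%:R - x) / (2 * x + c) * (P * Q).
  (* At k = 0 both sides vanish: the left by the factor k, the right because m = 0 or [P] contains
     the factor 0. *)
  have [k_eq0|k_gt0] := posnP k.
    have z : (m%:R - x) * P = 0.
      rewrite /P /x k_eq0 oppr0; case: (m) => [|m'].
        by rewrite addr0 mul0r.
      by rewrite pochhammerSl mul0r mulr0.
    rewrite /racah_death k_eq0 !mul0r; symmetry.
    transitivity (- m.+1%:R * ((x - be + c - 1) * (N%:R + al - x) *
      (x + c - 1 + N%:R)) / (2 * x + c) * Q * ((m%:R - x) * P)); first by ring.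
    by rewrite z mulr0.
  have xE : k.-1%:R = x - 1 by rewrite /x -{2}(prednK k_gt0) -natr1 addrK.
  have x1 : 1 <= x by rewrite ler1n.
  have P' : x * pochhammer (1 - x) m = P * (x - m%:R).
    have : - x * pochhammer (- x + 1) m = P * (- x + m%:R).
      by rewrite /P -pochhammerSr pochhammerSl.
    rewrite [- x + 1]addrC mulNr => /eqP; rewrite eqr_oppLR => /eqP ->; ring.
  rewrite xE [pochhammer (- (x - 1)) _]pochhammerSr.
  rewrite [pochhammer (x - 1 + c) _]pochhammerSl.
  rewrite [pochhammer (- x) _]pochhammerSl [pochhammer (x + c) _]pochhammerSr.
  have -> : x - 1 + c + 1 = x + c by ring.
  have -> : - (x - 1) = 1 - x by ring.
  have -> : - x + 1 = 1 - x by ring.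
  rewrite -/Q /racah_death -/x.
  transitivity (m.+1%:R * ((x - be + c - 1) * (N%:R + al - x) *
    (x + c - 1 + N%:R)) / (2 * x + c) *
    (x * pochhammer (1 - x) m * Q)); last by rewrite P'; ring.
  rewrite -[m.+1%:R]natr1.
  move: (pochhammer _ _) (N%:R : R) (m%:R : R) => Y y z.
  by rewrite /c; field; apply/andP; split; apply: lt0r_neq0; lra.
rewrite up down !pochhammerSr -/P -/Q /racah_eig /racah_lower -[m.+1%:R]natr1.
move: P Q (N%:R : R) (m%:R : R) {up down} => P Q y z.
by rewrite /c; field; apply: lt0r_neq0; lra.
Qed.

Lemma racah_expand n :
  racah N n a al be =
  \sum_(k < n.+1) racah_coef N n a al be k *: racah_basis a k.
Proof. by rewrite /racah big_mkord. Qed.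

(** Term ratio of the hypergeometric sum: its numerator (k - n)(k + n + al + be + 1) is a difference
    of eigenvalues. *)
Lemma racah_coefS n k : (k < n < N)%N ->
  racah_coef N n a al be k.+1 * racah_lower k =
  (racah_eig k - racah_eig n) * racah_coef N n a al be k.
Proof.
move: a_gt al_gt be_gt be_lt => a0 al0 be0 bec /andP[kn nN].
rewrite /racah_coef !pochhammerSr factS natrM !invfM /racah_lower /racah_eig /c.
have k0 : 0 <= k%:R :> R := ler0n _ _.
have : k%:R + 1 <= n%:R :> R by rewrite natr1 ler_nat.
have : n%:R + 1 <= N%:R :> R by rewrite natr1 ler_nat.
rewrite -[k.+1%:R]natr1; move: (pochhammer _ _)^-1 (pochhammer (be + 1) _)^-1
  (pochhammer (1 - _) _)^-1 (k`!%:R)^-1 (pochhammer _ _) (pochhammer _ _).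
move: k%:R n%:R (N%:R : R) k0 => x y z x0 yz xy p1 p2 p3 p4 p5 p6.
field; repeat (apply/andP; split); try (apply: lt0r_neq0; lra).
by apply: ltr0_neq0; lra.
Qed.

Lemma racah_eigen n k : (n < N)%N ->
  rL (fun j => (racah N n a al be).[racah_node a j]) k =
  - racah_eig n * (racah N n a al be).[racah_node a k].
Proof.
move=> nN; rewrite racah_expand; pose r := racah_coef N n a al be.
(* Truncation at m leaves a remainder along the last basis polynomial. The lower term of the next
   one cancels it by [racah_coefS], and at m = n it is zero. *)
suff partial m : (m <= n)%N ->
    rL (fun j => (\sum_(i < m.+1) r i *: racah_basis a i).[racah_node a j]) k =
    - racah_eig n * (\sum_(i < m.+1) r i *: racah_basis a i).[racah_node a k] +
    (racah_eig n - racah_eig m) * (r m * (racah_basis a m).[racah_node a k]).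
  by rewrite partial // subrr mul0r addr0.
elim: m => [|m IH] mn.
  rewrite /birth_death !big_ord1 /racah_basis big_geq // !hornerZ !hornerC.
  by rewrite /racah_eig !subrr; ring.
have := IH (ltnW mn); have := racah_coefS n m; rewrite mn nN => /(_ isT) rS.
have := racah_basis_eig m k; rewrite /birth_death => basis.
rewrite [in X in _ -> X]big_ord_recr /=.
set T := \sum_(i < m.+1) _; rewrite !hornerD !hornerZ -/r in rS * => Tm.
transitivity (racah_birth k * (T.[racah_node a k.+1] - T.[racah_node a k]) +
  racah_death k * (T.[racah_node a k.-1] - T.[racah_node a k]) +
  r m.+1 * (racah_birth k * ((racah_basis a m.+1).[racah_node a k.+1] -
    (racah_basis a m.+1).[racah_node a k]) +
  racah_death k * ((racah_basis a m.+1).[racah_node a k.-1] -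
    (racah_basis a m.+1).[racah_node a k]))); first by ring.
rewrite Tm basis mulrDr [r m.+1 * (racah_lower m * _)]mulrA rS; ring.
Qed.

(** The cofactor of n - m exceeds m + n - 1, since al + be > -2. *)
Lemma racah_eig_neq m n : (m < n)%N -> racah_eig n - racah_eig m != 0.
Proof.
move: al_gt be_gt => al0 be0 mn.
have m0 : 0 <= m%:R :> R := ler0n _ _.
have : m%:R + 1 <= n%:R :> R by rewrite natr1 ler_nat.
rewrite /racah_eig; move: m%:R n%:R m0 => x y x0 xy.
have -> : y * (y + al + be + 1) - x * (x + al + be + 1) =
  (y - x) * (x + y + al + be + 1) by ring.
by apply: lt0r_neq0; apply: mulr_gt0; lra.
Qed.

Lemma racah_sym (f g : nat -> R) : (0 < N)%N ->
  \sum_(k < N) racah_weight k * (rL f k * g k) =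
  \sum_(k < N) racah_weight k * (f k * rL g k).
Proof.
move=> N_gt0.
have birthN : racah_birth N.-1 = 0.
  have N1 : N.-1%:R = N%:R - 1 :> R by rewrite -{2}(prednK N_gt0) -natr1 addrK.
  by rewrite /racah_birth N1 subrr !(mulr0, mul0r).
have death0 : racah_death 0 = 0 by rewrite /racah_death !mul0r.
have := birth_death_sym _ _ _ racah_weight N.-1 f g death0 birthN.
rewrite (prednK N_gt0); apply => k kN.
by apply: racah_weight_balance; rewrite -(prednK N_gt0) ltnS.
Qed.

(** Moving the operator from [p] to the basis polynomial shows that (eig n - eig m) times the sum
    for m is a multiple of the sum for m - 1, hence zero by induction. *)
Lemma racah_ortho_basis n m : (n < N)%N -> (m < n)%N ->
  dsum R N (racah_node a) racah_weight
    (racah N n a al be * racah_basis a m) = 0.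
Proof.
move=> nN; have N_gt0 := leq_ltn_trans (leq0n _) nN.
set S := dsum _ _ _ _; set p := racah _ _ _ _ _.
have eig m' : \sum_(k < N) racah_weight k *
    (p.[racah_node a k] *
     rL (fun j => (racah_basis a m').[racah_node a j]) k) =
    - racah_eig n * S (p * racah_basis a m').
  rewrite -[LHS](racah_sym (fun j => p.[racah_node a j])
    (fun j => (racah_basis a m').[racah_node a j]) N_gt0) mulr_sumr.
  apply: eq_bigr => k _.
  by rewrite racah_eigen // hornerM; ring.
elim: m => [|m IH] mn; have := eig _; [move/(_ 0%N)|move/(_ m.+1)] => E;
  apply/eqP; have := racah_eig_neq _ _ mn; apply: contraR => S0.
- suff /eqP : racah_eig n * S (p * racah_basis a 0) = 0.
    by rewrite mulf_eq0 (negPf S0) orbF /racah_eig mul0r subr0.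
  apply/eqP; rewrite -oppr_eq0 -mulNr -E; apply/eqP/big1 => k _.
  by rewrite /birth_death /racah_basis big_geq // !hornerC !subrr; ring.
- suff /eqP : (racah_eig n - racah_eig m.+1) * S (p * racah_basis a m.+1) = 0.
    by rewrite mulf_eq0 (negPf S0) orbF.
  have : - racah_eig n * S (p * racah_basis a m.+1) =
     - racah_eig m.+1 * S (p * racah_basis a m.+1) +
     racah_lower m * S (p * racah_basis a m).
    rewrite -E /S /dsum !mulr_sumr -big_split; apply: eq_bigr => k _ /=.
    by rewrite racah_basis_eig !hornerM; ring.
  rewrite IH ?(ltnW mn) // mulr0 addr0 => eqS.
  by rewrite mulrBl -[racah_eig n * _]opprK -mulNr eqS; ring.
Qed.

Lemma racah_ortho n : (0 < n < N)%N ->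
  ortho_poly R N (racah_node a) racah_weight n (racah N n a al be).
Proof.
move: a_gt al_gt be_gt be_lt => a0 al0 be0 bec /andP[n_gt0 nN]; split.
  have n1 : 1 <= n%:R :> R by rewrite ler1n.
  have nN1 : n%:R + 1 <= N%:R :> R by rewrite natr1 ler_nat.
  (* For j < n the factors j - n and j + 1 - N are negative and all others positive; for al + be + n
     + 1 + j this uses n >= 1. *)
  have coef0 : racah_coef N n a al be n != 0.
    have f0 : n`!%:R != 0 :> R by rewrite pnatr_eq0 -lt0n fact_gt0.
    have poch0 u : (forall x, 0 <= x -> x + 1 <= n%:R -> u + x != 0) ->
        pochhammer u n != 0.
      move=> u_nz; apply: pochhammer_neq0 => j jn; apply: u_nz => //.
      by rewrite natr1 ler_nat.
    rewrite /racah_coef mulf_neq0 ?invr_eq0 ?mulf_neq0 //.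
    - by apply: poch0 => x x0 xn; apply: ltr0_neq0; lra.
    - by apply: poch0 => x x0 xn; apply: lt0r_neq0; lra.
    - by apply: poch0 => x x0 xn; apply: lt0r_neq0; lra.
    - by apply: poch0 => x x0 xn; apply: lt0r_neq0; lra.
    - by apply: poch0 => x x0 xn; apply: ltr0_neq0; lra.
  have [szB _] := racah_basis_lead a n.
  rewrite racah_expand big_ord_recr /= addrC size_polyDl size_scale // szB.
  rewrite ltnS; apply: leq_trans (size_sum _ _ _) _; apply/bigmax_leqP => k _.
  apply: leq_trans (size_scale_leq _ _) _.
  by have [-> _] := racah_basis_lead a k.
suff basis m : (m <= n)%N -> forall q : {poly R}, (size q <= m)%N ->
  dsum R N (racah_node a) racah_weight (racah N n a al be * q) = 0.
  by apply: basis.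
elim: m => [|m IH] mn q sq.
  move: sq; rewrite leqn0 size_poly_eq0 => /eqP ->.
  by rewrite mulr0 -(scale0r 0) dsumZ mul0r.
have [szB lB] := racah_basis_lead a m.
have lE : (racah_basis a m)`_m = lead_coef (racah_basis a m).
  by rewrite lead_coefE szB.
(* Subtracting this multiple of the basis polynomial of degree m kills the top coefficient of
   [q]. *)
pose t := q`_m / lead_coef (racah_basis a m).
have -> : q = (q - t *: racah_basis a m) + t *: racah_basis a m.
  by rewrite subrK.
rewrite mulrDr dsumD -scalerAr dsumZ racah_ortho_basis // mulr0 addr0.
apply: IH; first exact: ltnW.
apply/leq_sizeP => j; rewrite leq_eqVlt => /predU1P[<-|mj].
  by rewrite coefB coefZ lE /t divfK ?subrr.
rewrite coefB coefZ !nth_default ?szB //; first by rewrite mulr0 subr0.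
exact: leq_trans sq _.
Qed.

End FixedWeight.

(** * Monotonicity of the zeros in the parameters *)

Lemma racah_zero_lt N n a al be al' be' i : - (1 / 2) < a ->
  -1 < al -> -1 < be < 2 * a + 1 -> -1 < al' -> -1 < be' < 2 * a + 1 ->
  (0 < n < N)%N -> (i < n)%N ->
  (forall k, (k.+1 < N)%N ->
    racah_step N a al be k < racah_step N a al' be' k) ->
  racah_zero N n a al be i < racah_zero N n a al' be' i.
Proof.
move=> a0 al0 /andP[be0 bec] al0' /andP[be0' bec'] nN i_n step.
have wgt := racah_weight_gt0 N a al be a0 al0 be0 bec.
have wgt' := racah_weight_gt0 N a al' be' a0 al0' be0' bec'.
apply: (markov_zeros _ N (racah_node a) (racah_node_incr a a0)
  (racah_weight N a al be) (racah_weight N a al' be') n) => //.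
- by case/andP: nN.
- move=> j k /andP[jk]; elim: k jk => // k IH; rewrite ltnS leq_eqVlt => jk kN.
  (* From k to k + 1 the ratio of weights is multiplied by a ratio of steps, which exceeds 1. *)
  have kW : racah_weight N a al' be' k / racah_weight N a al be k <
      racah_weight N a al' be' k.+1 / racah_weight N a al be k.+1.
    have w0 := wgt _ (ltnW kN); have w0' := wgt' _ (ltnW kN).
    have s0 := racah_step_gt0 N a al be a0 al0 be0 bec k kN.
    rewrite !racah_weightS -mulf_div ltr_pMr ?divr_gt0 // ltr_pdivlMr // mul1r.
    exact: step.
  case/predU1P: jk => [->//|jk]; apply: lt_trans kW.
  by apply: IH => //; apply: ltnW.
- exact: racah_ortho.
- exact: racah_ortho.
Qed.

(** The only factor involving [al] is 1 + (2k + 2a + 2) / (N + al - k - 1). *)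
Lemma racah_step_lt_al N a al al' be k : - (1 / 2) < a ->
  -1 < al -> al < al' -> -1 < be < 2 * a + 1 -> (k.+1 < N)%N ->
  racah_step N a al' be k < racah_step N a al be k.
Proof.
move=> a0 al0 lt_al /andP[be0 bec] kN.
have k0 : 0 <= k%:R :> R := ler0n _ _.
have : k%:R + 2 <= N%:R :> R by rewrite -natrD ler_nat addn2.
rewrite /racah_step; move: k%:R (N%:R : R) k0 => x y x0 xy.
rewrite ltr_pM2r; last first.
  by repeat (apply: mulr_gt0 || rewrite invr_gt0); lra.
rewrite ltr_pM2l; last by apply: divr_gt0; lra.
rewrite ltr_pdivrMr; last by lra.
rewrite mulrAC ltr_pdivlMr; last by lra.
rewrite -subr_gt0.
have -> : (x + al + (2 * a + 1) + y) * (y + al' - x - 1) -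
  (x + al' + (2 * a + 1) + y) * (y + al - x - 1) =
  (al' - al) * (2 * x + 2 * a + 2) by ring.
by apply: mulr_gt0; lra.
Qed.

(** In (k + be + 1) / (k + c - be) the numerator grows with [be] and the positive denominator
    shrinks. *)
Lemma racah_step_lt_be N a al be be' k : - (1 / 2) < a ->
  -1 < al -> -1 < be -> be < be' -> be' < 2 * a + 1 -> (k.+1 < N)%N ->
  racah_step N a al be k < racah_step N a al be' k.
Proof.
move=> a0 al0 be0 lt_be bec kN.
have k0 : 0 <= k%:R :> R := ler0n _ _.
have : k%:R + 2 <= N%:R :> R by rewrite -natrD ler_nat addn2.
rewrite /racah_step; move: k%:R (N%:R : R) k0 => x y x0 xy.
rewrite ltr_pM2r; last first.
  by repeat (apply: mulr_gt0 || rewrite invr_gt0); lra.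
rewrite ltr_pM2r; last by apply: divr_gt0; lra.
rewrite ltr_pdivrMr; last by lra.
rewrite mulrAC ltr_pdivlMr; last by lra.
rewrite -subr_gt0.
have -> : (x + be' + 1) * (x + (2 * a + 1) - be) -
  (x + be + 1) * (x + (2 * a + 1) - be') =
  (be' - be) * (2 * x + 2 * a + 2) by ring.
by apply: mulr_gt0; lra.
Qed.

Lemma racah_zero_decr_al N n a be i : (0 < n < N)%N -> (i < n)%N ->
  - (1 / 2) < a -> -1 < be < 2 * a + 1 ->
  {in `]-1, +oo[ &,
    {homo (fun al => racah_zero N n a al be i) : x y /~ x < y}}.
Proof.
move=> nN i_n a0 be_in al al'; rewrite !in_itv !andbT /= => al0 al0' lt_al.
(* The notation [/~] reverses the order: here [al' < al], so [al] has the smaller step. *)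
by apply: racah_zero_lt => // k kN; apply: racah_step_lt_al.
Qed.

Lemma racah_zero_incr_be N n a al i : (0 < n < N)%N -> (i < n)%N ->
  - (1 / 2) < a -> -1 < al ->
  {in `]-1, 2 * a + 1[ &,
    {homo (fun be => racah_zero N n a al be i) : x y / x < y}}.
Proof.
move=> nN i_n a0 al0 be be'; rewrite !in_itv /= => be_in be_in' lt_be.
apply: racah_zero_lt => // k kN; apply: racah_step_lt_be => //.
  by case/andP: be_in.
by case/andP: be_in'.
Qed.

End RacahOrthogonality.

Theorem proposition3p5 (R : realType) (N n : nat) (a : R)
    (n_bounds : (1 <= n <= N - 1)%N) (a_gt : - (1 / 2) < a) :
  (0 <= a ->
    forall i : nat, (i < n)%N ->
      (forall be : R, be \in `]-1, 2 * a + 1[ ->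
        {in `]-1, +oo[ &,
          {homo (fun al : R => racah_zero N n a al be i) : x y /~ x < y}}) /\
      (forall al : R, al \in `]-1, +oo[ ->
        {in `]-1, 2 * a + 1[ &,
          {homo (fun be : R => racah_zero N n a al be i) : x y / x < y}})) /\
  (a < 0 ->
    forall i : nat, (i < n)%N ->
      (forall be : R, be \in `]a, 2 * a + 1[ ->
        {in `]-1, +oo[ &,
          {homo (fun al : R => racah_zero N n a al be i) : x y /~ x < y}}) /\
      (forall al : R, al \in `]-1, +oo[ ->
        {in `]a, 2 * a + 1[ &,
          {homo (fun be : R => racah_zero N n a al be i) : x y / x < y}})).
Proof.
have nN : (0 < n < N)%N by move: n_bounds; lia.
split=> [_|a_lt0] i i_n; split=> [be be_in|al].
- by apply: racah_zero_decr_al => //; rewrite in_itv in be_in.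
- by rewrite in_itv andbT => al0; apply: racah_zero_incr_be.
(* Since a > -1, the interval []a, 2 * a + 1[] lies in []-1, 2 * a + 1[]. *)
- apply: racah_zero_decr_al => //; move: be_in; rewrite in_itv /=.
  by case/andP=> lt_be ->; rewrite andbT; lra.
- rewrite in_itv andbT => al0 be be'; rewrite !in_itv /=.
  move=> /andP[lt_be be_lt] /andP[lt_be' be_lt'].
  by apply: racah_zero_incr_be => //; rewrite in_itv /=; apply/andP; split; lra.
Qed.
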